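(* Let $G$ be a finite simple graph on $n$ vertices with $m$ edges. Then $\mathcal{E}_{\mathrm{per}}(G)=2\sqrt m$ if and only if $G$ is isomorphic to the disjoint union of the star $K_{1,m}$ (on $m+1$ vertices) and $n-m-1$ isolated vertices, i.e. $G\cong K_{1,m}\sqcup (n-m-1)K_1$.
   Context: $A(G)$ is the adjacency matrix of $G$ and $\operatorname{per}(M)=\sum_{\sigma\in S_n}\prod_{i} m_{i,\sigma(i)}$ is the permanent. The permanental polynomial is $\pi(G,x)=\operatorname{per}(xI-A(G))$, with roots $\mu_1,\dots,\mu_n\in\mathbb{C}$ counted with multiplicity, and the permanental energy is $\mathcal{E}_{\mathrm{per}}(G)=\sum_{i=1}^n|\mu_i|$. $\sqcup$ denotes disjoint union of graphs and $K_1$ is a single isolated vertex. *)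

(* Defs.v *)
From HB Require Import structures.
From mathcomp Require Import all_boot all_order all_fingroup all_algebra.
From mathcomp Require Import complex reals.

Set Implicit Arguments.
Unset Strict Implicit.
Unset Printing Implicit Defensive.
Import GRing.Theory Num.Theory.
Local Open Scope ring_scope.

Record sgraph := SGraph {
  vertex :> finType;
  adj : rel vertex;
  adj_sym : symmetric adj;
  adj_irr : irreflexive adj }.

Definition edges (G : sgraph) : {set {set G}} :=
  [set [set p.1; p.2] | p : G * G & adj p.1 p.2].

Definition graph_iso (G H : sgraph) : Prop :=
  exists2 f : G -> H, bijective f & {mono f : x y / adj x y}.

Section DisjointUnion.
Variables G H : sgraph.

Definition union_adj (u v : G + H) : bool :=
  match u, v with
  | inl x, inl y => adj x y
  | inr x, inr y => adj x y
  | _, _ => false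
  end.

Lemma union_adj_sym : symmetric union_adj.
Proof. by move=> [x|x] [y|y] //=; rewrite adj_sym. Qed.

Lemma union_adj_irr : irreflexive union_adj.
Proof. by move=> [x|x] /=; rewrite adj_irr. Qed.

Definition disjoint_union : sgraph := SGraph union_adj_sym union_adj_irr.
End DisjointUnion.

Section CompleteBipartite.
Variables a b : nat.

Definition bipartite_adj (u v : 'I_a + 'I_b) : bool :=
  match u, v with
  | inl _, inr _ | inr _, inl _ => true
  | _, _ => false
  end.

Lemma bipartite_adj_sym : symmetric bipartite_adj.
Proof. by move=> [x|x] [y|y]. Qed.

Lemma bipartite_adj_irr : irreflexive bipartite_adj.
Proof. by move=> [x|x]. Qed.

Definition complete_bipartite : sgraph :=
  SGraph bipartite_adj_sym bipartite_adj_irr.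
End CompleteBipartite.

Section EdgelessGraph.
Variable k : nat.

Definition edgeless_adj (_ _ : 'I_k) : bool := false.

Lemma edgeless_adj_sym : symmetric edgeless_adj.
Proof. by []. Qed.

Lemma edgeless_adj_irr : irreflexive edgeless_adj.
Proof. by []. Qed.

Definition edgeless_graph : sgraph := SGraph edgeless_adj_sym edgeless_adj_irr.
End EdgelessGraph.

Definition permanent (R : comNzRingType) (n : nat) (M : 'M[R]_n) : R :=
  \sum_(s : 'S_n) \prod_(i < n) M i (s i).

Definition adjacency_mx (R : comNzRingType) (G : sgraph) : 'M[R]_#|G| :=
  \matrix_(i, j) (adj (enum_val i) (enum_val j))%:R.

(* char_poly_mx M is the matrix xI - M. *)
Definition permanental_poly (R : comNzRingType) (G : sgraph) : {poly R} :=
  permanent (char_poly_mx (adjacency_mx R G)).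

(* The roots of p listed with multiplicity: for p != 0, the unique sequence r,
   up to permutation, such that p = lead_coef p *: \prod_(z <- r) ('X - z%:P). *)
Definition roots_of (F : closedFieldType) (p : {poly F}) : seq F :=
  sval (closed_field_poly_normal p).

Definition permanental_energy (R : realType) (G : sgraph) : R :=
  \sum_(mu <- roots_of (permanental_poly R[i] G)) complex.Re `|mu|.

(* Main.v *)
(* The adjacency matrix vanishes on the diagonal, so the permanental polynomial
   is the sum of [(-1)^k x^(n-k)] over the permutations that send every point
   they move to a neighbour, k being the number of moved points. Hence the
   coefficients of [x^(n-1)] and [x^(n-2)] are 0 and m, and the roots satisfy
   [sum mu_i = 0] and [sum mu_i^2 = - 2m]. If moreover [(sum |mu_i|)^2 = 4m],
   equality in a triangle inequality forces [- mu_i^2 >= 0] and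
   [mu_i mu_j >= 0], so at most two roots are nonzero and no such permutation
   moves more than two points. Triangles and pairs of disjoint edges would give
   one, so all edges share a vertex. Conversely the polynomial of a star is
   [x^n + m x^(n-2)]. *)
Require Import Defs.
From mathcomp Require Import all_boot all_order all_fingroup all_algebra.
From mathcomp Require Import complex reals ring.

Set Implicit Arguments.
Unset Strict Implicit.
Unset Printing Implicit Defensive.
Import Order.TTheory GRing.Theory Num.Theory.
Local Open Scope ring_scope.

(** * Power sums of roots and extremal root sequences *)

(** Newton's identity for the second power sum: two below the top degree, the coefficient is the
    second elementary symmetric function of [s]. *)
Lemma sqr_sum_prod_XsubC (R : comNzRingType) (s : seq R) (k : nat) :
  size s = k.+2 ->
  (\sum_(x <- s) x) ^+ 2 =
    \sum_(x <- s) x ^+ 2 + 2 * (\prod_(x <- s) ('X - x%:P))`_k.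
Proof.
elim: s k => // z s IHs k [size_s]; rewrite !big_cons mulrBl coefB coefXM coefCM.
have -> : (\prod_(x <- s) ('X - x%:P))`_k = - \sum_(x <- s) x.
  by rewrite -coefPn_prod_XsubC size_s.
case: k size_s => [|k] size_s /=; last by rewrite sqrrD (IHs _ size_s); ring.
by case: s size_s {IHs} => [|y []] //= _; rewrite !big_seq1; ring.
Qed.

Section ExtremalRoots.
Variables (C : numClosedFieldType) (s : seq C) (a : C).
Hypothesis sum_s : \sum_(x <- s) x = 0.
Hypothesis sum_sqr_s : \sum_(x <- s) x ^+ 2 = - (2 * a).
Hypothesis sqr_sum_norm : (\sum_(x <- s) `|x|) ^+ 2 = 4 * a.

(* The terms of [sum_(i, j) F (i, j) = 4 a] have the moduli [|s_i| |s_j|],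
   whose sum is also [4 a], so they are all nonnegative. *)
Lemma extremal_root_products (i j : 'I_(size s)) :
  0 <= (if i == j then - s`_i ^+ 2 else s`_i * s`_j).
Proof.
pose F (p : 'I_(size s) * 'I_(size s)) :=
  if p.1 == p.2 then - s`_p.1 ^+ 2 else s`_p.1 * s`_p.2.
have normF p : `|F p| = `|s`_p.1| * `|s`_p.2|.
  by rewrite /F; case: eqP => [->|]; rewrite ?normrN ?normrX ?expr2 ?normrM.
have sum_nth (f : C -> C) : \sum_(x <- s) f x = \sum_(k < size s) f s`_k.
  by rewrite (big_nth 0) big_mkord.
have sumF : \sum_p F p = \sum_p `|F p|.
  transitivity (4 * a); last first.
    under eq_bigr => p _ do rewrite normF.
    rewrite -sqr_sum_norm expr2 (sum_nth Num.norm) big_distrlr /=.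
    by rewrite pair_bigA.
  rewrite -(pair_bigA _ (fun i j => F (i, j))) /=.
  (* The off-diagonal terms sum to the square of the sum minus the sum of squares; the diagonal
     subtracts the squares once more. The hypotheses turn this into [0 + 4 * a]. *)
  transitivity (\sum_(i < size s) \sum_(j < size s) s`_i * s`_j
                - 2 * \sum_(i < size s) s`_i ^+ 2).
    rewrite mulr_sumr -sumrB; apply: eq_bigr => k _.
    rewrite (bigD1 k) //= [in RHS](bigD1 k) //= /F eqxx /=.
    rewrite (eq_bigr (fun l : 'I__ => s`_k * s`_l)); first by ring.
    by move=> l /negPf /=; rewrite eq_sym => ->.
  rewrite -big_distrlr /= -(sum_nth id) -(sum_nth (fun x => x ^+ 2)).
  by rewrite sum_s sum_sqr_s; ring.
have := normC_sum_upper (fun p _ => lexx `|F p|) sumF.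
by move=> /(_ (i, j) isT) def_F; rewrite -[X in 0 <= X]/(F (i, j)) def_F.
Qed.

(** Up to sign the coefficient is an elementary symmetric function of degree at least three, and
    three roots at distinct indices always include a zero. *)
Lemma extremal_coef_eq0 (k : nat) :
  (k.+2 < size s)%N -> (\prod_(x <- s) ('X - x%:P))`_k = 0.
Proof.
move=> lt_k; rewrite coef_prod_XsubC; last by do 3!apply: ltnW.
rewrite big1 ?mulr0 // => I /eqP card_I.
apply/eqP/negPn/negP => /prodf_neq0 nz_I.
have /card_gt2P [x [y [z [[xI yI zI] [xy yz zx]]]]] : (2 < #|I|)%N.
  by rewrite card_I ltn_subRL addnC.
(* [(xy)(yz)(zx) >= 0] whereas [(-x^2)(-y^2)(-z^2) >= 0]. *)
have pos : 0 <= (s`_x * s`_y) * (s`_y * s`_z) * (s`_z * s`_x).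
  have := (extremal_root_products x y, extremal_root_products y z,
           extremal_root_products z x).
  rewrite (negPf xy) (negPf yz) (negPf zx) => -[[pxy pyz] pzx].
  exact: mulr_ge0 (mulr_ge0 pxy pyz) pzx.
have neg : 0 <= - s`_x ^+ 2 * - s`_y ^+ 2 * - s`_z ^+ 2.
  have := (extremal_root_products x x, extremal_root_products y y,
           extremal_root_products z z).
  by rewrite !eqxx => -[[? ?] ?]; rewrite !mulr_ge0.
have /eqP : (s`_x * s`_y) * (s`_y * s`_z) * (s`_z * s`_x) = 0.
  apply: le_anti; rewrite pos andbT -oppr_ge0.
  by rewrite (_ : - _ = - s`_x ^+ 2 * - s`_y ^+ 2 * - s`_z ^+ 2) //; ring.
by rewrite !mulf_eq0 !(negPf (nz_I _ _)).
Qed.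
End ExtremalRoots.

(** * Expansion of the permanental polynomial over permutations of the vertices *)

Lemma permanent_enum_val (R : comNzRingType) (T : finType) (F : T -> T -> R) :
  permanent (\matrix_(i, j < #|T|) F (enum_val i) (enum_val j)) =
  \sum_(s : {perm T}) \prod_x F x (s x).
Proof.
pose conj (s : {perm T}) : 'S_#|T| := perm (inj_comp
  (inj_comp (@enum_rank_inj T) (@perm_inj _ s)) (@enum_val_inj T predT)).
pose conj_inv (s : 'S_#|T|) : {perm T} := perm (inj_comp
  (inj_comp (@enum_val_inj T predT) (@perm_inj _ s)) (@enum_rank_inj T)).
rewrite /permanent (reindex conj) /=; last first.
  by exists conj_inv => s _; apply/permP => x;
    rewrite !permE /= !permE /= ?enum_valK ?enum_rankK ?enum_valK.
apply: eq_bigr => s _; rewrite [RHS](reindex (@enum_val T predT)) /=; last first.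
  by apply: onW_bij; exact: enum_val_bij.
by apply: eq_bigr => i _; rewrite mxE permE /= enum_rankK.
Qed.

(** The nontrivial cycles of such a permutation are disjoint edges and oriented cycles of [G]: these
    are its Sachs subgraphs, with orientations. *)
Definition adj_perms (G : sgraph) : {set {perm G}} :=
  [set s : {perm G} | [forall x, (s x != x) ==> adj x (s x)]].

Lemma adj_permsP (G : sgraph) (s : {perm G}) :
  reflect (forall x, s x != x -> adj x (s x)) (s \in adj_perms G).
Proof. by rewrite inE; exact: (iffP 'forall_implyP). Qed.

Definition moved (T : finType) (s : {perm T}) : {set T} := [set x | s x != x].

(** A fixed point contributes ['X], as there are no loops; a moved point contributes [-1] if its
    image is a neighbour and otherwise kills the product. *)
Lemma permanental_polyE (R : comNzRingType) (G : sgraph) :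
  permanental_poly R G =
  \sum_(s in adj_perms G) (-1) ^+ #|moved s| * 'X^(#|G| - #|moved s|).
Proof.
pose F (x y : G) : {poly R} := 'X *+ (x == y) - (adj x y)%:R%:P.
transitivity (permanent (\matrix_(i, j < #|G|) F (enum_val i) (enum_val j))).
  congr permanent; apply/matrixP => i j; rewrite !mxE /F.
  by rewrite (inj_eq enum_val_inj).
rewrite permanent_enum_val [RHS]big_mkcond /=; apply: eq_bigr => s _.
rewrite (bigID (mem (moved s))) /= mulrC.
rewrite (eq_bigr (fun=> 'X)) => [|x]; last first.
  by rewrite inE negbK /F => /eqP ->; rewrite eqxx adj_irr mulr1n polyC0 subr0.
rewrite prodr_const (_ : #|_| = #|~: moved s|); last first.
  by apply: eq_card => x; rewrite in_setC.
rewrite -(cardsC (moved s)) addKn mulrC; case: ifPn => [/adj_permsP sP|].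
  rewrite (eq_bigr (fun=> -1)) ?prodr_const // => x; rewrite inE => nx.
  by rewrite /F eq_sym (negPf nx) (sP x nx) mulr0n polyC1 sub0r.
rewrite inE negb_forall => /existsP [x]; rewrite negb_imply => /andP [nx nadj].
by rewrite (bigD1 x) ?inE //= /F eq_sym (negPf nx) (negPf nadj) mulr0n polyC0 subr0 !mul0r.
Qed.

Lemma coef_permanental_poly (R : comNzRingType) (G : sgraph) (k : nat) :
  (k <= #|G|)%N ->
  (permanental_poly R G)`_(#|G| - k) =
  (-1) ^+ k * #|[set s in adj_perms G | #|moved s| == k]|%:R.
Proof.
move=> le_k; rewrite permanental_polyE coef_sum -sum1_card natr_sum mulr_sumr.
rewrite big_mkcond [RHS]big_mkcond /=; apply: eq_bigr => s _.
rewrite [in RHS]inE; case: (s \in adj_perms G) => //=.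
rewrite -(rmorph_sign polyC) coefCM coefXn.
have le_s : (#|moved s| <= #|G|)%N := max_card _.
(* Both numbers are at most [#|G|], where truncated subtraction from [#|G|] is injective. *)
rewrite (_ : (_ == _) = (#|moved s| == k)); last first.
  by apply/eqP/eqP => [eq_k|->//]; rewrite -(subKn le_s) -eq_k subKn.
by case: eqP => [->|_]; rewrite ?mulr0.
Qed.

Lemma moved_eq0 (T : finType) (s : {perm T}) : (#|moved s| == 0%N) = (s == 1%g).
Proof.
rewrite cards_eq0; apply/eqP/eqP => [/setP s1|->]; last first.
  by apply/setP => x; rewrite !inE perm1 eqxx.
by apply/permP => x; have := s1 x; rewrite !inE perm1 => /negbFE/eqP.
Qed.

Lemma moved_perm (T : finType) (s : {perm T}) x :
  (s x \in moved s) = (x \in moved s).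
Proof. by rewrite !inE (inj_eq perm_inj). Qed.

(** A permutation maps its moved points among themselves, so a lone one would be fixed. *)
Lemma moved_neq1 (T : finType) (s : {perm T}) : #|moved s| != 1%N.
Proof.
apply/negP => /cards1P [x mx].
have sx : s x = x by apply/set1P; rewrite -mx moved_perm mx set11.
by move: (set11 x); rewrite -mx inE sx eqxx.
Qed.

Lemma moved_tperm (T : finType) (x y : T) :
  x != y -> moved (tperm x y) = [set x; y].
Proof.
move=> nxy; apply/setP => z; rewrite !inE.
case: tpermP => [->|->|/eqP/negPf-> /eqP/negPf->]; rewrite ?eqxx ?orbT //.
  by rewrite eq_sym.
Qed.

Lemma moved_eq_tperm (T : finType) (s : {perm T}) (x y : T) :
  moved s = [set x; y] -> s = tperm x y.
Proof.
move=> ms; have out z : z != x -> z != y -> s z = z.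
  move=> nx ny; apply/eqP/negPn; have := in_set2 z x y.
  by rewrite -ms inE (negPf nx) (negPf ny) => ->.
have [mx my] : s x != x /\ s y != y.
  by split; [have := set21 x y | have := set22 x y]; rewrite -ms inE.
have sx : s x = y.
  have := set21 x y; rewrite -ms -moved_perm ms.
  by case/set2P => // sx; rewrite sx eqxx in mx.
have sy : s y = x.
  have := set22 x y; rewrite -ms -moved_perm ms.
  by case/set2P => // sy; rewrite sy eqxx in my.
by apply/permP => z; case: tpermP => [->|->|/eqP nx /eqP ny]; rewrite // out.
Qed.

Lemma tperm_adj_perms (G : sgraph) (x y : G) : adj x y -> tperm x y \in adj_perms G.
Proof.
move=> xy; apply/adj_permsP => z; case: tpermP => [->|->|]; rewrite ?eqxx //.
by rewrite adj_sym.
Qed.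

Lemma adj_neq (G : sgraph) (x y : G) : adj x y -> x != y.
Proof. by apply: contraTneq => ->; rewrite adj_irr. Qed.

(** A permutation moving exactly two points swaps them, so [moved] matches these permutations with
    the edges. *)
Lemma card_adj_perms2 (G : sgraph) :
  #|[set s in adj_perms G | #|moved s| == 2]| = #|edges G|.
Proof.
rewrite -(@card_in_imset _ _ (@moved G)); last first.
  move=> s t /setIdP [_ /cards2P [x [y [_ ms]]]] _ mst.
  by rewrite (moved_eq_tperm ms) (@moved_eq_tperm _ t x y) // -mst ms.
apply: eq_card => e; apply/imsetP/imsetP => [[s]|[[x y]]].
  case/setIdP => /adj_permsP sP /cards2P [x [y [_ ms]]] ->.
  exists (x, y) => //; rewrite inE /=; have /permP/(_ x) := moved_eq_tperm ms.
  rewrite tpermL => <-; apply: sP.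
  by have := set21 x y; rewrite -ms inE.
rewrite inE /= => xy ->; exists (tperm x y); last by rewrite moved_tperm // adj_neq.
by rewrite inE tperm_adj_perms // moved_tperm ?cards2 ?adj_neq.
Qed.

Lemma id_adj_perms (G : sgraph) : 1%g \in adj_perms G.
Proof. by apply/adj_permsP => x; rewrite perm1 eqxx. Qed.

Lemma coef_card_permanental_poly (R : comNzRingType) (G : sgraph) :
  (permanental_poly R G)`_#|G| = 1.
Proof.
rewrite -[X in _`_X]subn0 coef_permanental_poly // expr0 mul1r.
rewrite (_ : [set s in _ | _] = [set 1%g]) ?cards1 //.
apply/setP => s; rewrite in_set in_set1 moved_eq0.
by case: eqP => [->|_]; rewrite ?andbF // id_adj_perms.
Qed.

Lemma size_permanental_poly (R : comNzRingType) (G : sgraph) :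
  size (permanental_poly R G) = #|G|.+1.
Proof.
apply/eqP; rewrite eqn_leq andbC ltnNge; apply/andP; split.
  apply/negP => /(nth_default 0)/eqP.
  by rewrite coef_card_permanental_poly oner_eq0.
rewrite permanental_polyE; apply: (leq_trans (size_sum _ _ _)).
apply/bigmax_leqP => s _; rewrite -(rmorph_sign polyC) mul_polyC.
by apply: leq_trans (size_scale_leq _ _) _; rewrite size_polyXn ltnS leq_subr.
Qed.

(** * Factorization over the roots *)

Lemma permanental_poly_roots (F : closedFieldType) (G : sgraph) :
  permanental_poly F G =
  \prod_(z <- roots_of (permanental_poly F G)) ('X - z%:P).
Proof.
rewrite /roots_of; case: closed_field_poly_normal => r /= {1}->.
by rewrite lead_coefE size_permanental_poly coef_card_permanental_poly scale1r.
Qed.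

Lemma size_roots_permanental_poly (F : closedFieldType) (G : sgraph) :
  size (roots_of (permanental_poly F G)) = #|G|.
Proof.
apply: succn_inj; rewrite -(@size_permanental_poly F).
by rewrite [in RHS]permanental_poly_roots size_prod_XsubC.
Qed.

(** * Stars and permutations moving few points *)

(** Isolated vertices are allowed; in an edgeless graph every vertex is a centre. *)
Definition star_center (G : sgraph) (c : G) : Prop :=
  forall x y, adj x y -> (x == c) || (y == c).

(** A moved [x] is adjacent to [s x], so one of the two is [c]. *)
Lemma moved_star (G : sgraph) (c : G) (s : {perm G}) :
  star_center c -> s \in adj_perms G -> (#|moved s| <= 2)%N.
Proof.
move=> star_c /adj_permsP sP.
suff /subset_leq_card : moved s \subset [set c; s^-1%g c].
  by move/leq_trans; apply; rewrite cards2; case: eqP.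
apply/subsetP => x; rewrite !inE => /sP /star_c /orP [->//|/eqP <-].
by rewrite permK eqxx orbT.
Qed.

Section FewMoved.
Variable G : sgraph.
Hypothesis few_moved : forall s, s \in adj_perms G -> (#|moved s| <= 2)%N.

Lemma few_moved_collision (s : {perm G}) (x y z : G) :
    s \in adj_perms G -> x \in moved s -> y \in moved s -> z \in moved s ->
  [|| x == y, y == z | z == x].
Proof.
move=> /few_moved; rewrite leqNgt => /card_gt2P few mx my mz.
apply: contraT; rewrite !negb_or => /and3P [xy yz zx].
by case: few; exists x, y, z.
Qed.

Lemma few_moved_triangle_free (x y z : G) :
  adj x y -> adj y z -> adj z x -> False.
Proof.
move=> xy yz zx.
have [[nxy nyz] nzx] := (adj_neq xy, adj_neq yz, adj_neq zx).
(* The left factor acts first, so this is the rotation [x -> y -> z -> x] of the triangle. *)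
pose s := (tperm x y * tperm x z)%g.
have [sx sy sz] : [/\ s x = y, s y = z & s z = x].
  by split; rewrite permM ?tpermL ?tpermR ?[tperm x y z]tpermD ?tpermL ?tpermR //
    ?tpermD // eq_sym.
have /few_moved_collision : s \in adj_perms G.
  apply/adj_permsP => w.
  case: (eqVneq w x) => [->|wx]; first by rewrite sx.
  case: (eqVneq w y) => [->|wy]; first by rewrite sy.
  case: (eqVneq w z) => [->|wz]; first by rewrite sz.
  by rewrite permM !tpermD ?eqxx // eq_sym.
move=> /(_ x y z); rewrite !inE sx sy sz (negPf nxy) (negPf nyz) (negPf nzx).
by rewrite (eq_sym y) (eq_sym z) (eq_sym x z) nxy nyz nzx => /(_ isT isT isT).
Qed.

(** Swapping the ends of two disjoint edges simultaneously would move four points. *)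
Lemma few_moved_incident (x y u v : G) :
  adj x y -> adj u v -> [|| u == x, u == y, v == x | v == y].
Proof.
move=> xy uv; apply: contraT; rewrite !negb_or => /and4P [ux uy vx vy].
have [nxy nuv] := (adj_neq xy, adj_neq uv).
pose s := (tperm x y * tperm u v)%g.
have [sx sy su sv] : [/\ s x = y, s y = x, s u = v & s v = u].
  split; rewrite permM; first by rewrite tpermL tpermD.
  - by rewrite tpermR tpermD.
  - by rewrite [tperm x y u]tpermD 1?eq_sym // tpermL.
  - by rewrite [tperm x y v]tpermD 1?eq_sym // tpermR.
have /few_moved_collision : s \in adj_perms G.
  apply/adj_permsP => w.
  case: (eqVneq w x) => [->|wx]; first by rewrite sx.
  case: (eqVneq w y) => [->|wy]; first by rewrite sy adj_sym.
  case: (eqVneq w u) => [->|wu]; first by rewrite su.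
  case: (eqVneq w v) => [->|wv]; first by rewrite sv adj_sym.
  by rewrite permM !tpermD ?eqxx // eq_sym.
move=> /(_ x y u); rewrite !inE sx sy su (negPf nxy) (negPf ux) eq_sym.
by rewrite nxy (eq_sym v) nuv (eq_sym y) (negPf uy) => /(_ isT isT isT).
Qed.

(** Given an edge [ab], either [a] is a centre or some edge [bc] avoids [a]. Then [b] is a centre:
    an edge avoiding [b] meets both [ab] and [bc], hence is [ac] and closes a triangle. Nonemptiness
    provides a centre when there is no edge. *)
Lemma few_moved_star : (0 < #|G|)%N -> exists c : G, star_center c.
Proof.
case/card_gt0P => x0 _.
case: (pickP (fun p : G * G => adj p.1 p.2)) => [[a b] /= ab|none]; last first.
  by exists x0 => x y xy; have := none (x, y); rewrite /= xy.
case: (pickP (fun p : G * G => [&& adj p.1 p.2, p.1 != a & p.2 != a])) =>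
    [[x y] /= /and3P [xy xa ya]|none]; last first.
  exists a => x y xy; have := none (x, y); rewrite /= xy /=.
  by do 2!case: eqP.
have [c bc ca] : exists2 c, adj b c & c != a.
  have := few_moved_incident ab xy; rewrite (negPf xa) (negPf ya) /=.
  by case/orP => /eqP <-; [exists y | exists x => //; rewrite adj_sym].
exists b => u v uv; apply: contraT; rewrite negb_or => /andP [ub vb].
have := few_moved_incident bc uv; rewrite (negPf ub) (negPf vb) /= => uvc.
have := few_moved_incident ab uv; rewrite (negPf ub) (negPf vb) /= orbF => uva.
have cadj : adj c a.
  case/orP: uva => /eqP ua; case/orP: uvc => /eqP uc.
  - by rewrite -uc ua eqxx in ca.
  - by rewrite -ua -uc adj_sym.
  - by rewrite -ua -uc.
  - by rewrite -uc ua eqxx in ca.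
by case: (few_moved_triangle_free ab bc cadj).
Qed.
End FewMoved.

(** Only the identity and the transpositions along edges survive. If [#|G| < 2], the exponent is
    truncated but the edge count is zero. *)
Lemma permanental_poly_star (R : comNzRingType) (G : sgraph) (c : G) :
  star_center c ->
  permanental_poly R G = 'X^#|G| + 'X^(#|G| - 2) *+ #|edges G|.
Proof.
move=> star_c; rewrite permanental_polyE (bigD1 1%g) ?id_adj_perms //=.
have /eqP -> : #|moved (1%g : {perm G})| == 0%N by rewrite moved_eq0.
rewrite expr0 mul1r subn0; congr (_ + _).
rewrite -card_adj_perms2 -sumr_const; apply: eq_big => [s|s /andP [sS s1]].
  rewrite inE; case sS: (s \in adj_perms G) => //=.
  rewrite -moved_eq0; have := moved_star star_c sS; have := moved_neq1 s.
  by case: #|moved s| => [|[|[]]].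
have := moved_star star_c sS; have := moved_neq1 s; rewrite -moved_eq0 in s1.
by case: #|moved s| s1 => [|[|[]]] //; rewrite expr2 mulrN1 opprK mul1r.
Qed.

(** * Isomorphism with the model star *)

Section StarIso.
Variables (G : sgraph) (c : G).
Hypothesis star_c : star_center c.

Lemma card_edges_star : #|edges G| = #|[set x | adj c x]|.
Proof.
rewrite -(@card_in_imset _ _ (fun x => [set c; x])); last first.
  move=> x y; rewrite !inE => cx cy eq_xy.
  have := set22 c x; rewrite eq_xy => /set2P [xc|//].
  by rewrite xc adj_irr in cx.
apply: eq_card => e; apply/imsetP/imsetP => [[[x y]]|[x]].
  rewrite inE /= => xy ->; case/orP: (star_c xy) => /eqP eq_c; subst c.
    by exists y; rewrite ?inE.
  by exists x; rewrite ?inE 1?adj_sym 1?setUC.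
by rewrite inE => cx ->; exists (c, x); rewrite ?inE.
Qed.

Lemma star_graph_iso :
  graph_iso G (disjoint_union (complete_bipartite 1 #|edges G|)
                              (edgeless_graph (#|G| - #|edges G| - 1))).
Proof.
set m := #|edges G|; set N := [set x | adj c x].
have cN : c \notin N by rewrite inE adj_irr.
set k := (_ - 1)%N; set W := ~: (c |: N).
have card_N : size (enum N) = m by rewrite -cardE /m card_edges_star.
have card_m : (m.+1 <= #|G|)%N.
  (* The [1] is rewritten as the truth value of [c \notin N], to match [cardsU1]. *)
  by rewrite -card_N -cardE -add1n -[1%N]/(true : nat) -cN -cardsU1 max_card.
have card_W : size (enum W) = k.
  by rewrite -cardE cardsCs setCK cardsU1 cN cardE card_N /k add1n subnS subn1.
(* Leaves enumerate the neighbours of [c], isolated vertices the rest. The lists have lengths [m]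
   and [k], so the default [c] of [nth] is never reached. *)
pose g (u : 'I_1 + 'I_m + 'I_k) : G :=
  match u with
  | inl (inl _) => c
  | inl (inr j) => nth c (enum N) j
  | inr j => nth c (enum W) j
  end.
have gN (j : 'I_m) : adj c (nth c (enum N) j).
  have : nth c (enum N) j \in N by rewrite -mem_enum mem_nth // card_N.
  by rewrite inE.
have gW (j : 'I_k) : ~~ adj c (nth c (enum W) j) /\ nth c (enum W) j != c.
  have : nth c (enum W) j \in W by rewrite -mem_enum mem_nth // card_W.
  by rewrite !inE negb_or => /andP [].
have g_inj : injective g.
  have absurd_N j : c = nth c (enum N) j -> (j < m)%N -> False.
    by move=> def_c lt_j; have := gN (Ordinal lt_j); rewrite /= -def_c adj_irr.
  have absurd_NW (i : 'I_m) (j : 'I_k) : nth c (enum N) i = nth c (enum W) j -> False.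
    by move=> eq_ij; have [] := gW j; rewrite -eq_ij gN.
  have absurd_W (j : 'I_k) : nth c (enum W) j = c -> False.
    by move=> eq_c; have [_] := gW j; rewrite eq_c eqxx.
  move=> [[i|i]|i] [[j|j]|j] /=.
  - by rewrite (ord1 i) (ord1 j).
  - by move=> /absurd_N/(_ (ltn_ord j)).
  - by move=> /esym /absurd_W.
  - by move=> /esym /absurd_N/(_ (ltn_ord i)).
  - move/eqP; rewrite nth_uniq ?card_N ?enum_uniq // => /eqP eq_ij.
    by congr (inl (inr _)); exact: val_inj.
  - by move/absurd_NW.
  - by move/absurd_W.
  - by move/esym/absurd_NW.
  - move/eqP; rewrite nth_uniq ?card_W ?enum_uniq // => /eqP eq_ij.
    by congr inr; exact: val_inj.
have [f gK fK] : bijective g.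
  (* The cardinalities agree because [m.+1 <= #|G|] makes the truncated subtraction exact. *)
  apply: inj_card_bij => //; rewrite !card_sum !card_ord /k -subnDA addn1 add1n.
  by rewrite subnKC.
exists f; first by exists g.
have outside x y : x != c -> y != c -> adj x y = false.
  by move=> xc yc; apply/negP => /star_c; rewrite (negPf xc) (negPf yc).
have nN (j : 'I_m) : nth c (enum N) j != c by rewrite eq_sym; exact: adj_neq.
have nW (j : 'I_k) : nth c (enum W) j != c by case: (gW j).
move=> x y; rewrite -[in RHS](fK x) -[in RHS](fK y).
case: (f x) (f y) => [[i|i]|i] [[j|j]|j] /=.
- by rewrite adj_irr.
- by rewrite gN.
- by case: (gW j) => /negPf ->.
- by rewrite adj_sym gN.
- by rewrite outside.
- by rewrite outside.
- by rewrite adj_sym; case: (gW i) => /negPf ->.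
- by rewrite outside.
- by rewrite outside.
Qed.
End StarIso.

Lemma graph_iso_star (G : sgraph) (m k : nat) :
  graph_iso G (disjoint_union (complete_bipartite 1 m) (edgeless_graph k)) ->
  exists c : G, star_center c.
Proof.
case=> f [g fK gK] f_mono; exists (g (inl (inl ord0))) => x y.
rewrite -f_mono -[x == _](inj_eq (can_inj fK)) -[y == _](inj_eq (can_inj fK)) gK.
by case: (f x) (f y) => [[i|i]|i] [[j|j]|j] //= _; rewrite ?ord1 eqxx ?orbT.
Qed.

(** * Energy of stars and the equality case *)

Lemma energy_complex (R : realType) (G : sgraph) :
  (permanental_energy R G)%:C%C =
  \sum_(mu <- roots_of (permanental_poly R[i] G)) `|mu|.
Proof.
rewrite /permanental_energy rmorph_sum.
by apply: eq_bigr => z _; rewrite normc_def.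
Qed.

(** Factorizations into monic linear factors agree up to order, so any explicit list of roots gives
    the energy. *)
Lemma energy_prod_XsubC (R : realType) (G : sgraph) (s : seq R[i]) :
  permanental_poly R[i] G = \prod_(z <- s) ('X - z%:P) ->
  permanental_energy R G = \sum_(z <- s) complex.Re `|z|.
Proof.
move=> def_p; apply/perm_big/prod_XsubC_eq.
by rewrite -(permanental_poly_roots R[i] G).
Qed.

Lemma energy_star (R : realType) (G : sgraph) (c : G) :
  star_center c -> permanental_energy R G = 2 * Num.sqrt #|edges G|%:R.
Proof.
move=> /(permanental_poly_star R[i]); set m := #|edges G| => def_p.
(* The edgeless case is separate: a single vertex leaves no room for the two roots [w] and [- w]. *)
have [m0|m_gt0] := posnP m.
  rewrite (@energy_prod_XsubC _ _ (nseq #|G| 0)).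
    by rewrite big_nseq m0 sqrtr0 mulr0 normr0 /= iter_addr_0 mul0rn.
  by rewrite def_p m0 mulr0n addr0 big_nseq subr0 iter_mulr_1.
have ge2 : (2 <= #|G|)%N.
  move: m_gt0; rewrite /m -card_adj_perms2 => /card_gt0P [s].
  case/setIdP => _ /eqP card_s; apply: leq_trans (max_card (moved s)).
  by rewrite card_s.
pose w : R[i] := (0 +i* Num.sqrt m%:R)%C.
have w2 : w ^+ 2 = - m%:R.
  rewrite expr2 /w; simpc; rewrite -expr2 sqr_sqrtr ?ler0n //.
  by rewrite -[m%:R in RHS](rmorph_nat (real_complex R)) -rmorphN.
rewrite (@energy_prod_XsubC _ _ [:: w, - w & nseq (#|G| - 2) 0]).
  rewrite !big_cons big_nseq normrN normr0 /= iter_addr_0 mul0rn addr0.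
  by rewrite /= expr0n /= add0r sqr_sqrtr ?ler0n //; ring.
rewrite def_p !big_cons big_nseq subr0 iter_mulr_1 polyCN opprK.
rewrite (_ : 'X^#|G| = 'X^2 * 'X^(#|G| - 2)); last by rewrite -exprD subnKC.
rewrite mulrA -subr_sqr -rmorphXn /= w2 polyCN opprK mulrDl.
by rewrite polyC_natr mulr_natl.
Qed.

Lemma star_of_energy (R : realType) (G : sgraph) :
  (0 < #|G|)%N -> permanental_energy R G = 2 * Num.sqrt #|edges G|%:R ->
  exists c : G, star_center c.
Proof.
move=> G_gt0 energy; apply: few_moved_star => // s sS.
rewrite leqNgt; apply/negP => gt2; have le_s : (#|moved s| <= #|G|)%N := max_card _.
have ge2 : (2 <= #|G|)%N by apply: leq_trans le_s; exact: ltnW.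
pose r := roots_of (permanental_poly R[i] G).
have size_r : size r = #|G| := size_roots_permanental_poly _ _.
have def_p : _ = \prod_(z <- r) ('X - z%:P) := permanental_poly_roots R[i] G.
have sum_r : \sum_(x <- r) x = 0.
  apply/eqP; rewrite -oppr_eq0 -coefPn_prod_XsubC size_r -?lt0n //.
  rewrite -def_p -subn1 coef_permanental_poly // (_ : [set s in _ | _] = set0).
    by rewrite cards0 mulr0.
  by apply/setP => t; rewrite !inE (negPf (moved_neq1 t)) andbF.
have sum_sqr_r : \sum_(x <- r) x ^+ 2 = - (2 * #|edges G|%:R).
  have size_r2 : size r = (#|G| - 2).+2 by rewrite size_r -addn2 subnK.
  have := sqr_sum_prod_XsubC size_r2; rewrite sum_r -def_p coef_permanental_poly //.
  rewrite card_adj_perms2 expr0n expr2 mulrN1 opprK mul1r => /esym/eqP.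
  by rewrite addr_eq0 => /eqP.
have sqr_sum_norm : (\sum_(x <- r) `|x|) ^+ 2 = 4 * #|edges G|%:R.
  rewrite -energy_complex energy -rmorphXn exprMn sqr_sqrtr ?ler0n //.
  by rewrite rmorphM rmorphXn !rmorph_nat -natrX.
(* All permutations moving equally many points have the same sign in the coefficient, so nothing
   cancels: a zero coefficient says there are none, yet [s] is one. *)
have := extremal_coef_eq0 sum_r sum_sqr_r sqr_sum_norm (k := #|G| - #|moved s|).
rewrite -def_p size_r coef_permanental_poly // => coef0.
have /coef0/eqP : ((#|G| - #|moved s|).+2 < #|G|)%N.
  by rewrite -addn2 -[X in (_ < X)%N](subnK le_s) ltn_add2l.
rewrite mulf_eq0 signr_eq0 pnatr_eq0 /= => /eqP/cards0_eq/setP/(_ s).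
by rewrite in_set sS eqxx in_set0.
Qed.

(* n - m - 1 is truncated subtraction; when n < m + 1 the right-hand side
   is still false, since that graph then has m + 1 <> n vertices. *)
Theorem theorem3p2 (R : realType) (G : sgraph) (n m : nat)
    (n_gt0 : (0 < n)%N) (card_G : #|G| = n) (card_edges : #|edges G| = m) :
  permanental_energy R G = 2 * Num.sqrt m%:R
  <-> graph_iso G
        (disjoint_union (complete_bipartite 1 m) (edgeless_graph (n - m - 1))).
Proof.
rewrite -card_G -card_edges in n_gt0 *; split.
  by move=> /(star_of_energy n_gt0) [c]; exact: star_graph_iso.
by move=> /graph_iso_star [c]; exact: energy_star.
Qed.
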